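(* Let $\mu,m\ge 0$ and let $\{\delta_k\}_{k\ge0}$, $\{\widetilde\delta_k\}_{k\ge0}$ be sequences of nonnegative numbers. Suppose that for every $k$ there is a constant $\bar L_{k+1}\ge 0$ such that $\psi_{\delta_k}(x,y)$ (with associated values $f_{\delta_k}(y)$) is a $(\delta_k,\bar L_{k+1},\mu,m,V,\|\cdot\|)$-model of $f$ at every point $y$, and that $V[y](x)\ge\frac12\|x-y\|^2$ for all $x\in Q$, $y\in \mathrm{ri}\,Q$. Let $x_*$ be a minimizer of $f$ on $Q$, and let $\{x_k\},\{u_k\},\{A_k\}$ be generated by the fast adaptive gradient method described in the context. Then after $N\ge1$ iterations $$f(x_N)-f(x_* )\le\frac{V[u_0](x_* )}{A_N}+\frac{2\sum_{k=0}^{N-1}A_{k+1}\delta_k}{A_N}+\frac{\sum_{k=0}^{N-1}\widetilde\delta_k}{A_N},$$ $$V[u_N](x_* )\le\frac{V[u_0](x_* )}{1+A_N\mu+A_Nm}+\frac{2\sum_{k=0}^{N-1}A_{k+1}\delta_k}{1+A_N\mu+A_Nm}+\frac{\sum_{k=0}^{N-1}\widetilde\delta_k}{1+A_N\mu+A_Nm}.$$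
   Context: $Q$ is a convex subset of a finite-dimensional real vector space $E$ with norm $\|\cdot\|$; the problem is $\min_{x\in Q}f(x)$. $d$ is a convex function on $Q$, continuously differentiable on the relative interior $\mathrm{ri}\,Q$, and $V[y](x)=d(x)-d(y)-\langle\nabla d(y),x-y\rangle$ for $x\in Q$, $y\in\mathrm{ri}\,Q$. Whenever $V[y](x)$ is written, $y$ is understood to be a point for which it is defined; in particular the points $u_k$, $y_{k+1}$ below are assumed to be such points. Model: for $\delta,L,\mu,m\ge0$, $\psi_\delta(x,y)$ is a $(\delta,L,\mu,m,V,\|\cdot\|)$-model of $f$ at $y$, with associated number $f_\delta(y)$, if for all $x\in Q$ $$\mu V[y](x)\le f(x)-\left(f_\delta(y)+\psi_\delta(x,y)\right)\le\frac L2\|x-y\|^2+\delta,$$ $\psi_\delta(x,y)$ is convex in $x$, $\psi_\delta(x,x)=0$ for all $x\in Q$, and $\psi(\cdot)=\psi_\delta(\cdot,y)$ satisfies $\psi(x)\ge\psi(z)+\langle g,x-z\rangle+mV[z](x)$ for all $x,z\in Q$ and all $g\in\partial\psi(z)$. Inexact minimization: for convex $\Psi$ and $\widetilde\delta\ge0$, $\operatorname{argmin}^{\widetilde\delta}_{x\in Q}\Psi(x)$ denotes some point $\widetilde x\in Q$ for which there exists $h\in\partial\Psi(\widetilde x)$ with $\langle h,x-\widetilde x\rangle\ge-\widetilde\delta$ for all $x\in Q$. Fast adaptive gradient method: input $x_0$, $\mu,m\ge0$, $\{\delta_k\}$, $L_0>0$. Set $y_0=u_0=x_0$, $\alpha_0=0$,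 $A_0=0$. For $k=0,1,2,\dots$: find the smallest integer $i_k\ge0$ such that, with $L_{k+1}=2^{i_k-1}L_k$, with $\alpha_{k+1}$ the largest root of $A_{k+1}(1+A_k\mu+A_km)=L_{k+1}\alpha_{k+1}^2$ where $A_{k+1}=A_k+\alpha_{k+1}$, and with $$y_{k+1}=\frac{\alpha_{k+1}u_k+A_kx_k}{A_{k+1}},$$ $$\phi_{k+1}(x)=\alpha_{k+1}\psi_{\delta_k}(x,y_{k+1})+(1+A_k\mu+A_km)V[u_k](x)+\alpha_{k+1}\mu V[y_{k+1}](x),$$ $$u_{k+1}=\operatorname{argmin}^{\widetilde\delta_k}_{x\in Q}\phi_{k+1}(x),\qquad x_{k+1}=\frac{\alpha_{k+1}u_{k+1}+A_kx_k}{A_{k+1}},$$ one has $$f_{\delta_k}(x_{k+1})\le f_{\delta_k}(y_{k+1})+\psi_{\delta_k}(x_{k+1},y_{k+1})+\frac{L_{k+1}}2\|x_{k+1}-y_{k+1}\|^2+\delta_k.$$ *)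

(* Defs.v *)
From HB Require Import structures.
From mathcomp Require Import all_boot all_order all_algebra.
From mathcomp Require Import all_classical all_reals all_analysis.

Set Implicit Arguments.
Unset Strict Implicit.
Unset Printing Implicit Defensive.

Import Order.TTheory GRing.Theory Num.Theory.
Import numFieldNormedType.Exports.

Local Open Scope classical_set_scope.
Local Open Scope ring_scope.

(* MathComp-Analysis has no join of normed modules and finite-dimensional
   vector spaces.  The dual space of [E] is ['Hom(E, R^o)]. *)
#[short(type="normedVectType")]
HB.structure Definition NormedVector (K : numDomainType) :=
  {T of NormedModule K T & Vector K T}.

Definition affine_set (R : realType) (E : lmodType R) (A : set E) : Prop :=
  forall (x y : E) (t : R), A x -> A y -> A (t *: x + (1 - t) *: y).

Definition affine_hull (R : realType) (E : lmodType R) (Q : set E) : set E :=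
  smallest (@affine_set R E) Q.

Definition relint (R : realType) (E : normedVectType R) (Q : set E) : set E :=
  [set x | Q x /\ \forall z \near x, affine_hull Q z -> Q z].

(* [g] is a derivative at [y] of [d] seen as a function on [Q]; when [Q] is not
   full-dimensional, [g] is only determined on the directions of [Q]. *)
Definition is_gradient (R : realType) (E : normedVectType R) (Q : set E)
    (d : E -> R) (y : E) (g : 'Hom(E, R^o)) : Prop :=
  forall e : R, 0 < e -> \forall x \near nbhs y,
    Q x -> `|d x - d y - g (x - y)| <= e * `|x - y|.

(* Continuity of the gradient is asked for along the directions of [Q], the
   only ones on which it is determined.  In finite dimension this is
   continuity for the dual norm of the direction space. *)
Definition C1_relint (R : realType) (E : normedVectType R) (Q : set E)
    (d : E -> R) (grad : E -> 'Hom(E, R^o)) : Prop :=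
  (forall y, relint Q y -> is_gradient Q d y (grad y)) /\
  (forall x z, Q x -> Q z ->
     {within relint Q, continuous (fun y : E => grad y (x - z))}).

(* V[y](x); independent of the choice of [grad] for y in ri Q and x in Q. *)
Definition bregman (R : realType) (E : normedVectType R) (d : E -> R)
    (grad : E -> 'Hom(E, R^o)) (y x : E) : R :=
  d x - d y - grad y (x - y).

(* The functions below live on [Q], hence so do their subgradients. *)
Definition subdifferential (R : realType) (E : normedVectType R) (Q : set E)
    (psi : E -> R) (z : E) : set 'Hom(E, R^o) :=
  [set g | forall x, Q x -> psi z + g (x - z) <= psi x].

Definition is_minimizer (R : realType) (E : normedVectType R) (Q : set E)
    (f : E -> R) (z : E) : Prop :=
  Q z /\ forall x, Q x -> f z <= f x.

(* The (delta, L, mu, m, V, |.|)-model [psi x y] = psi_delta(x, y) of [f] at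
   [y], with [fd y] = f_delta(y).  The relative strong convexity is asked for
   at those [z] where V[z] is defined. *)
Record is_model (R : realType) (E : normedVectType R) (Q : set E)
    (V : E -> E -> R) (f : E -> R) (delta L mu m : R)
    (fd : E -> R) (psi : E -> E -> R) (y : E) : Prop := IsModel {
  model_lower : forall x, Q x -> mu * V y x <= f x - (fd y + psi x y);
  model_upper : forall x, Q x ->
    f x - (fd y + psi x y) <= L / 2 * `|x - y| ^+ 2 + delta;
  model_convex : @convex_function R E Q (psi^~ y);
  model_diag : forall x, Q x -> psi x x = 0;
  model_strong : forall x z g, Q x -> relint Q z ->
    subdifferential Q (psi^~ y) z g ->
    psi z y + g (x - z) + m * V z x <= psi x y }.

Definition approx_argmin (R : realType) (E : normedVectType R) (Q : set E)
    (Psi : E -> R) (eps : R) (xt : E) : Prop :=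
  Q xt /\ exists2 h, subdifferential Q Psi xt h &
    forall x, Q x -> - eps <= h (x - xt).

Definition largest_root (R : realType) (p q : R -> R) (a : R) : Prop :=
  p a = q a /\ forall b, p b = q b -> b <= a.

Record fgm_state (R : realType) (E : normedVectType R) := FGMState {
  st_L : R; st_alpha : R; st_A : R; st_y : E; st_u : E; st_x : E }.

Definition fgm_coef (R : realType) (mu m A : R) : R := 1 + A * mu + A * m.

Definition fgm_phi (R : realType) (E : normedVectType R) (V : E -> E -> R)
    (mu m : R) (psi : E -> E -> R) (A alpha : R) (u y x : E) : R :=
  alpha * psi x y + fgm_coef mu m A * V u x + alpha * mu * V y x.

(* [t] is a candidate for the iterate following [s], computed with the value
   [i] of the line-search counter. *)
Record fgm_trial (R : realType) (E : normedVectType R) (Q : set E)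
    (V : E -> E -> R) (mu m : R) (psi : E -> E -> R) (deltat : R)
    (s : fgm_state E) (i : nat) (t : fgm_state E) : Prop := FGMTrial {
  trial_L : st_L t = 2 ^ (i%:Z - 1) * st_L s;
  trial_alpha : largest_root
    (fun a => (st_A s + a) * fgm_coef mu m (st_A s))
    (fun a => st_L t * a ^+ 2) (st_alpha t);
  trial_A : st_A t = st_A s + st_alpha t;
  trial_y : st_y t =
    (st_A t)^-1 *: (st_alpha t *: st_u s + st_A s *: st_x s);
  trial_u : approx_argmin Q
    (fgm_phi V mu m psi (st_A s) (st_alpha t) (st_u s) (st_y t))
    deltat (st_u t);
  trial_x : st_x t =
    (st_A t)^-1 *: (st_alpha t *: st_u t + st_A s *: st_x s) }.

Definition fgm_accept (R : realType) (E : normedVectType R) (fd : E -> R)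
    (psi : E -> E -> R) (delta : R) (t : fgm_state E) : Prop :=
  fd (st_x t) <= fd (st_y t) + psi (st_x t) (st_y t)
                 + st_L t / 2 * `|st_x t - st_y t| ^+ 2 + delta.

(* Approximate minimizers are not unique: minimality of i_k means that, for
   each smaller counter, the candidate that was computed failed the test. *)
Definition fgm_step (R : realType) (E : normedVectType R) (Q : set E)
    (V : E -> E -> R) (mu m : R) (fd : E -> R) (psi : E -> E -> R)
    (delta deltat : R) (s t : fgm_state E) : Prop :=
  exists i : nat,
    [/\ fgm_trial Q V mu m psi deltat s i t,
        fgm_accept fd psi delta t &
        forall j, (j < i)%N -> exists2 t' : fgm_state E,
          fgm_trial Q V mu m psi deltat s j t' & ~ fgm_accept fd psi delta t'].

(* [s 0], ..., [s N] are the states of the first [N] iterations; [psi] and [fd]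
   are indexed by the value of delta.  The last two fields say that V[u_k] and
   V[y_{k+1}] are defined. *)
Record fgm_run (R : realType) (E : normedVectType R) (Q : set E)
    (V : E -> E -> R) (mu m : R) (fd : R -> E -> R) (psi : R -> E -> E -> R)
    (delta deltat : nat -> R) (x0 : E) (L0 : R) (N : nat)
    (s : nat -> fgm_state E) : Prop := FGMRun {
  run_init : s 0%N = FGMState L0 0 0 x0 x0 x0;
  run_step : forall k, (k < N)%N ->
    fgm_step Q V mu m (fd (delta k)) (psi (delta k)) (delta k) (deltat k)
      (s k) (s k.+1);
  run_u : forall k, (k <= N)%N -> relint Q (st_u (s k));
  run_y : forall k, (k < N)%N -> relint Q (st_y (s k.+1)) }.

(* Main.v *)
Require Import Defs.
From HB Require Import structures.
From mathcomp Require Import all_boot all_order all_algebra.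
From mathcomp Require Import all_classical all_reals all_analysis.
From mathcomp Require Import ring lra.

Import Order.TTheory GRing.Theory Num.Theory.
Import numFieldNormedType.Exports.

Local Open Scope classical_set_scope.
Local Open Scope ring_scope.

(* With c_k = 1 + A_k mu + A_k m, the quantity
   A_k (f x_k - f xs) + c_k V[u_k](xs) grows by at most
   2 A_{k+1} delta_k + deltat_k per iteration; both bounds follow by dropping
   one of its two nonnegative terms.  For one iteration, the acceptance test,
   convexity of psi, the equation L alpha^2 = A_{k+1} c_k and
   |u_{k+1} - u_k|^2 <= 2 V[u_k](u_{k+1}) bound A_{k+1} f(x_{k+1}) by
   A_k f(x_k) + alpha f_delta(y) + phi(u_{k+1}) and error terms; then
   phi(u_{k+1}) is compared with phi(xs) by the relative strong convexity of
   phi.  The model is also used at x_{k+1}, which lies in the relative interior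
   because that set is convex. *)

(** * Convex combinations, affine hulls and the relative interior *)

Lemma convex_set_comb {R : realType} {E : lmodType R} {Q : set E} (x y : E)
    (t : R) :
  @convex_set R E Q -> 0 <= t <= 1 -> Q x -> Q y -> Q (t *: x + (1 - t) *: y).
Proof.
move=> Qc /andP[t0 t1] Qx Qy.
by have /set_mem := Qc x y (Itv01 t0 t1) (mem_set Qx) (mem_set Qy).
Qed.

Lemma convex_function_comb {R : realType} {E : lmodType R} {Q : set E}
    {p : E -> R} (x y : E) (t : R) :
  @convex_function R E Q p -> 0 <= t <= 1 -> Q x -> Q y ->
  p (t *: x + (1 - t) *: y) <= t * p x + (1 - t) * p y.
Proof.
move=> pc /andP[t0 t1] Qx Qy.
exact: (pc (Itv01 t0 t1) x y (mem_set Qx) (mem_set Qy)).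
Qed.

Lemma affine_hull_sub {R : realType} {E : lmodType R} (Q : set E) :
  Q `<=` affine_hull Q.
Proof. exact: sub_gen_smallest. Qed.

Lemma affine_hull_affine {R : realType} {E : lmodType R} (Q : set E) :
  affine_set (affine_hull Q).
Proof.
by move=> x y t Qx Qy M MQ; case: (MQ) => + _; apply; [apply: Qx|apply: Qy].
Qed.

(** Affine sets are given by two-point combinations, so the three-point one is built in two stages:
    the midpoint of [x] and [z], then extrapolation from [y] through it with coefficient 2. *)
Lemma affine_set_translate {R : realType} {E : lmodType R} (A : set E)
    (x y z : E) :
  affine_set A -> A x -> A y -> A z -> A (x + (z - y)).
Proof.
move=> Aaff Ax Ay Az.
have := Aaff _ _ 2 (Aaff x z (1 / 2) Ax Az) Ay.
rewrite scalerDr !scalerA.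
have -> : 2 * (1 / 2) = 1 :> R by field.
have -> : 2 * (1 - 1 / 2) = 1 :> R by field.
have -> : 1 - 2 = -1 :> R by ring.
by rewrite !scale1r scaleN1r addrA.
Qed.

Lemma relint_sub {R : realType} {E : normedVectType R} {Q : set E} [x : E] :
  relint Q x -> Q x.
Proof. by case. Qed.

(** Let [w] be the combination. For [z] near [w] in the affine hull, the translates [x + (z - w)]
    and [y + (z - w)] stay in the hull and tend to [x] and [y], hence lie in [Q]; combining them
    with weight [t] gives back [z]. *)
Lemma relint_comb {R : realType} {E : normedVectType R} {Q : set E} (x y : E)
    (t : R) :
  @convex_set R E Q -> 0 <= t <= 1 -> relint Q x -> relint Q y ->
  relint Q (t *: x + (1 - t) *: y).
Proof.
move=> Qc t01 [Qx nx] [Qy ny]; split; first exact: convex_set_comb.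
set w := t *: x + _.
have Qw : Q w by exact: convex_set_comb.
have shift (v : E) : (fun z => v + (z - w)) @ w --> v.
  have /cvgD : cst v @ w --> v by exact: cvg_cst.
  move=> /(_ (fun z => z - w) 0); rewrite addr0; apply.
  rewrite -[X in _ --> X](subrr w); apply: cvgB; [exact: cvg_id|exact: cvg_cst].
have Hx := shift x _ nx; have Hy := shift y _ ny.
near=> z => Az.
have Ax : Q (x + (z - w)).
  have : affine_hull Q (x + (z - w)) -> Q (x + (z - w)) by near: z; exact: Hx.
  apply; apply: (affine_set_translate _ _ _ _ (affine_hull_affine Q)) => //.
    exact: affine_hull_sub.
  exact: affine_hull_sub.
have Ay : Q (y + (z - w)).
  have : affine_hull Q (y + (z - w)) -> Q (y + (z - w)) by near: z; exact: Hy.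
  apply; apply: (affine_set_translate _ _ _ _ (affine_hull_affine Q)) => //.
    exact: affine_hull_sub.
  exact: affine_hull_sub.
have := convex_set_comb _ _ t Qc t01 Ax Ay.
rewrite (scalerDr t x) (scalerDr (1 - t) y) addrACA -/w -scalerDl.
by rewrite [t + _]addrC subrK scale1r addrC subrK.
Unshelve. all: by end_near. Qed.

(** * Gradients relative to [Q] and the Bregman divergence *)

Lemma is_gradientD {R : realType} {E : normedVectType R} (Q : set E)
    (p q : E -> R) (z : E) (g h : 'Hom(E, R^o)) :
  is_gradient Q p z g -> is_gradient Q q z h ->
  is_gradient Q (fun x => p x + q x) z (g + h).
Proof.
move=> pg qh e e0; have e20 : 0 < e / 2 by rewrite divr_gt0.
near=> x => Qx.
have Hp : `|p x - p z - g (x - z)| <= e / 2 * `|x - z|.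
  by move: Qx; near: x; exact: pg.
have Hq : `|q x - q z - h (x - z)| <= e / 2 * `|x - z|.
  by move: Qx; near: x; exact: qh.
rewrite add_lfunE.
have -> : p x + q x - (p z + q z) - (g (x - z) + h (x - z)) =
  (p x - p z - g (x - z)) + (q x - q z - h (x - z)) by ring.
apply: le_trans (ler_normD _ _) _.
by rewrite (_ : e = e / 2 + e / 2) ?mulrDl ?lerD//; field.
Unshelve. all: by end_near. Qed.

Lemma is_gradientZ {R : realType} {E : normedVectType R} (Q : set E)
    (c : R) (p : E -> R) (z : E) (g : 'Hom(E, R^o)) :
  is_gradient Q p z g -> is_gradient Q (fun x => c * p x) z (c *: g).
Proof.
(* Adding 1 to [|c|] keeps the tolerance well defined when [c] is 0. *)
move=> pg e e0; have c0 : 0 < `|c| + 1 by rewrite ltr_wpDl.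
have e20 : 0 < e / (`|c| + 1) by rewrite divr_gt0.
near=> x => Qx.
have Hp : `|p x - p z - g (x - z)| <= e / (`|c| + 1) * `|x - z|.
  by move: Qx; near: x; exact: pg.
rewrite scale_lfunE /=.
have -> : c * p x - c * p z - c *: g (x - z) = c * (p x - p z - g (x - z)).
  by rewrite /GRing.scale /=; ring.
rewrite normrM; apply: (le_trans (ler_wpM2l (normr_ge0 c) Hp)).
rewrite mulrA ler_wpM2r// mulrCA ler_piMr ?(ltW e0)//.
by rewrite ler_pdivrMr// mul1r lerDl.
Unshelve. all: by end_near. Qed.

(** As a function of its last argument, [bregman d grad y] differs from [d] by an affine map, so
    both have the same first-order remainder at [z]. *)
Lemma is_gradient_bregman {R : realType} {E : normedVectType R} (Q : set E)
    (d : E -> R) (grad : E -> 'Hom(E, R^o)) (y z : E) :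
  is_gradient Q d z (grad z) ->
  is_gradient Q (bregman d grad y) z (grad z - grad y).
Proof.
move=> dg e /dg; apply: filterS => x dx Qx.
rewrite (_ : _ - _ - _ = d x - d z - grad z (x - z)); first exact: dx.
rewrite /bregman add_lfunE opp_lfunE.
have -> : grad y (x - y) = grad y (x - z) + grad y (z - y).
  by rewrite -linearD /= addrA subrK.
ring.
Qed.

Lemma bregman_three_points {R : realType} {E : normedVectType R} (d : E -> R)
    (grad : E -> 'Hom(E, R^o)) (y z x : E) :
  bregman d grad y x =
  bregman d grad y z + (grad z - grad y) (x - z) + bregman d grad z x.
Proof.
rewrite /bregman add_lfunE opp_lfunE.
have -> : grad y (x - y) = grad y (x - z) + grad y (z - y).
  by rewrite -linearD /= addrA subrK.
ring.
Qed.

(** * Subgradient calculus and positivity of the step size *)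

(** The inequality for [h] is tested at [w = z + t (x - z)]: convexity bounds [p w] by its chord,
    differentiability bounds [q w - q z] by [t g (x - z)] plus at most [t e]. Dividing by [t] leaves
    the claim up to an arbitrary [e > 0]. *)
Lemma subdifferential_subr {R : realType} {E : normedVectType R} {Q : set E}
    {p q : E -> R} {z : E} {g h : 'Hom(E, R^o)} :
  @convex_set R E Q -> @convex_function R E Q p -> Q z ->
  is_gradient Q q z g ->
  subdifferential Q (fun x => p x + q x) z h ->
  subdifferential Q p z (h - g).
Proof.
move=> Qc pc Qz qg hsub x Qx.
rewrite add_lfunE opp_lfunE; apply/ler_addgt0Pr => e e0.
set n := `|x - z|.
have n0 : 0 < n + 1 by rewrite ltr_wpDl// normr_ge0.
have en0 : 0 < e / (n + 1) by rewrite divr_gt0.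
have /nbhs_ballP[r /= r0 rP] := qg _ en0.
(* The cap 1 keeps [w] in [Q]; the other bound puts [w] in the ball of radius [r] around [z], with
   [n + 1] as divisor to allow [x = z]. *)
pose t := Num.min 1 (r / 2 / (n + 1)).
have t0 : 0 < t by rewrite lt_min ltr01 /= !divr_gt0.
have t1 : t <= 1 by rewrite ge_min lexx.
have t01 : 0 <= t <= 1 by rewrite ltW.
pose w := t *: x + (1 - t) *: z.
have Qw : Q w by exact: convex_set_comb.
have wz : w - z = t *: (x - z).
  by rewrite /w scalerBl scale1r scalerBr addrA addrAC addrK.
have nwz : `|w - z| = t * n by rewrite wz normrZ gtr0_norm.
have tn : t * n < r.
  have : t <= r / 2 / (n + 1) by rewrite ge_min lexx orbT.
  rewrite ler_pdivlMr// => H; apply: le_lt_trans (_ : r / 2 < r); last by lra.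
  by apply: le_trans H; rewrite ler_wpM2l ?ltW// ltrDl.
have := rP w _ Qw.
rewrite -ball_normE /= distrC nwz => /(_ tn).
rewrite wz linearZ /= => /ler_normlP[_ Hq].
have := hsub w Qw; rewrite wz linearZ /= => Hh.
have := convex_function_comb x z t pc t01 Qx Qz; rewrite -/w => Hp.
have en : e / (n + 1) * n <= e.
  by rewrite mulrAC ler_pdivrMr// ler_wpM2l ?ltW// ltrDl.
rewrite /GRing.scale /= in Hq Hh *.
have H : t * (p z + (h (x - z) - g (x - z))) <= t * (p x + e).
  have : t * (e / (n + 1) * n) <= t * e by rewrite ler_pM2l.
  nra.
by rewrite ler_pM2l in H.
Qed.

Lemma largest_root_gt0 {R : realType} (A c L al : R) :
  0 <= A -> 0 < c -> 0 < L ->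
  largest_root (fun a => (A + a) * c) (fun a => L * a ^+ 2) al -> 0 < al.
Proof.
move=> A0 c0 L0 [_ almax].
(* [D] is the discriminant of [L a^2 - c a - A c]. Its root [b] is positive, and the largest root is
   at least [b]. *)
pose D := c ^+ 2 + 4 * L * A * c.
have D0 : 0 <= D by rewrite /D addr_ge0 ?sqr_ge0// !mulr_ge0// ltW.
pose b := (c + Num.sqrt D) / (2 * L).
have b0 : 0 < b.
  by apply: divr_gt0; [rewrite ltr_pwDl ?sqrtr_ge0|rewrite mulr_gt0].
apply: lt_le_trans b0 (almax _ _).
have Ln0 : L != 0 by rewrite gt_eqF.
have HD : Num.sqrt D ^+ 2 = c ^+ 2 + 4 * L * A * c by rewrite sqr_sqrtr.
have -> : L * b ^+ 2 =
    (c ^+ 2 + 2 * c * Num.sqrt D + Num.sqrt D ^+ 2) / (4 * L).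
  by rewrite /b; field.
by rewrite HD /b; field.
Qed.

Lemma subdifferential_scalel {R : realType} {E : normedVectType R} {Q : set E}
    {p : E -> R} {z : E} {g : 'Hom(E, R^o)} {a : R} :
  0 < a -> subdifferential Q (fun x => a * p x) z g ->
  subdifferential Q p z (a^-1 *: g).
Proof.
move=> a0 psub x /psub ax; rewrite scale_lfunE /=.
by rewrite -(ler_pM2l a0) mulrDr /GRing.scale /= mulVKf// gt_eqF.
Qed.

Lemma convex_functionZ {R : realType} {E : lmodType R} {Q : set E}
    {p : E -> R} {a : R} :
  0 <= a -> @convex_function R E Q p ->
  @convex_function R E Q (fun x => a * p x).
Proof.
move=> a0 pc t x y Qx Qy; apply: (le_trans (ler_wpM2l a0 (pc t x y Qx Qy))).
by rewrite !convRE mulrDr !mulrA ![a * _]mulrC.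
Qed.

(** * Relative strong convexity of the auxiliary function phi *)

Lemma fgm_coefD {R : realType} (mu m A al : R) :
  fgm_coef mu m (A + al) = fgm_coef mu m A + al * mu + al * m.
Proof. by rewrite /fgm_coef; ring. Qed.

Lemma fgm_coef_ge1 {R : realType} (mu m A : R) :
  0 <= mu -> 0 <= m -> 0 <= A -> 1 <= fgm_coef mu m A.
Proof.
by move=> mu0 m0 A0; rewrite /fgm_coef -addrA lerDl addr_ge0 ?mulr_ge0.
Qed.

(* Subtracting the gradient of the Bregman part from a subgradient [h] of phi
   leaves a subgradient of [al * psi], to which the relative strong convexity
   of psi applies; the three-point identity turns the Bregman part into
   [V z x]. *)
Lemma fgm_phi_strong {R : realType} {E : normedVectType R} {Q : set E}
    {f d : E -> R} {grad : E -> 'Hom(E, R^o)} {delta L mu m : R} {fd : E -> R}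
    {psi : E -> E -> R} {A al : R} {u y z : E} {h : 'Hom(E, R^o)} (x : E)
    (V := bregman d grad) (phi := fgm_phi V mu m psi A al u y) :
  @convex_set R E Q -> is_gradient Q d z (grad z) ->
  is_model Q V f delta L mu m fd psi y ->
  0 < al -> relint Q z -> subdifferential Q phi z h -> Q x ->
  phi z + h (x - z) + fgm_coef mu m (A + al) * V z x <= phi x.
Proof.
move=> Qc dg model al0 zri hsub Qx.
set c := fgm_coef mu m A.
pose q x := c * V u x + al * mu * V y x.
pose g := c *: (grad z - grad u) + (al * mu) *: (grad z - grad y).
have qg : is_gradient Q q z g.
  by apply: is_gradientD; apply: is_gradientZ; exact: is_gradient_bregman.
have hsub' : subdifferential Q (fun x => al * psi x y + q x) z h.
  by move=> w /hsub; rewrite /phi /fgm_phi /q !addrA.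
have psic := convex_functionZ (ltW al0) (model_convex model).
have gsub := subdifferential_scalel al0
  (subdifferential_subr Qc psic (relint_sub zri) qg hsub').
have := model_strong model Qx zri gsub.
rewrite -(ler_pM2l al0) /= !(scale_lfunE, add_lfunE, opp_lfunE) /GRing.scale /=.
rewrite (mulrDr al) (mulrDr al (psi z y)) mulVKf ?gt_eqF// -/V.
(* The weight of [V z x] is [c + al * mu] from the two Bregman terms plus [al * m] from psi, which
   is the coefficient at [A + al]. *)
rewrite /phi /fgm_phi fgm_coefD -/c /V.
rewrite (bregman_three_points d grad u z x) (bregman_three_points d grad y z x).
rewrite !(add_lfunE, opp_lfunE) -/V.
lra.
Qed.

(** * Estimate for one iteration *)

Lemma convex_comb_divE {R : realType} {E : lmodType R} (a b : R) (u x : E) :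
  a + b != 0 ->
  (a + b)^-1 *: (b *: u + a *: x) =
  b / (a + b) *: u + (1 - b / (a + b)) *: x.
Proof.
move=> ab0; rewrite scalerDr !scalerA ![_^-1 * _]mulrC; congr (_ + _ *: _).
by field.
Qed.

Lemma fgm_step_estimate {R : realType} {E : normedVectType R} {Q : set E}
    {f d : E -> R} {grad : E -> 'Hom(E, R^o)} {mu m delta deltat L : R}
    {fd : E -> R} {psi : E -> E -> R} {xs : E} {s t : fgm_state E} {i : nat}
    (V := bregman d grad) :
  @convex_set R E Q ->
  (forall y, relint Q y -> is_gradient Q d y (grad y)) ->
  0 <= mu -> 0 <= m -> 0 <= delta ->
  (forall y, relint Q y -> is_model Q V f delta L mu m fd psi y) ->
  (forall z y, Q z -> relint Q y -> 1 / 2 * `|z - y| ^+ 2 <= V y z) ->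
  Q xs ->
  0 < st_L s -> 0 <= st_A s -> relint Q (st_u s) -> relint Q (st_x s) ->
  relint Q (st_u t) -> relint Q (st_y t) ->
  fgm_trial Q V mu m psi deltat s i t -> fgm_accept fd psi delta t ->
  [/\ 0 < st_L t, 0 < st_A t, relint Q (st_x t) &
      st_A t * (f (st_x t) - f xs) + fgm_coef mu m (st_A t) * V (st_u t) xs <=
      st_A s * (f (st_x s) - f xs) + fgm_coef mu m (st_A s) * V (st_u s) xs
      + 2 * (st_A t * delta) + deltat].
Proof.
move=> Qc dg mu0 m0 delta0 model Vge Qxs Ls0 As0 us xsri ut yt
  [tL tal tA ty [_ [h hsub hge]] tx] acc.
have Lt0 : 0 < st_L t by rewrite tL mulr_gt0// exprz_gt0.
have c1 := fgm_coef_ge1 _ _ _ mu0 m0 As0.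
have al0 := largest_root_gt0 _ _ _ _ As0 (lt_le_trans ltr01 c1) Lt0 tal.
have At0 : 0 < st_A t by rewrite tA ltr_wpDl.
have Atn : st_A s + st_alpha t != 0 by rewrite -tA gt_eqF.
have th01 : 0 <= st_alpha t / st_A t <= 1.
  by rewrite divr_ge0 ?(ltW al0) ?(ltW At0)//= ler_pdivrMr// mul1r tA lerDr.
have txE : st_x t = st_alpha t / st_A t *: st_u t
                    + (1 - st_alpha t / st_A t) *: st_x s.
  by rewrite tx tA convex_comb_divE.
have tyE : st_y t = st_alpha t / st_A t *: st_u s
                    + (1 - st_alpha t / st_A t) *: st_x s.
  by rewrite ty tA convex_comb_divE.
have xt : relint Q (st_x t) by rewrite txE; exact: relint_comb.
split=> //.
have V0 z y : Q z -> relint Q y -> 0 <= V y z.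
  by move=> Qz yri; apply: le_trans (Vge z y Qz yri); rewrite mulr_ge0 ?sqr_ge0.
have My := model _ yt.
have hxs := hge _ Qxs.
have Hphi := fgm_phi_strong xs Qc (dg _ ut) My al0 ut hsub Qxs.
(* The model at [st_x t], evaluated at that same point, has no quadratic term. This is the first of
   the two [delta]; the second comes from the acceptance test. *)
have Hfx : f (st_x t) <= fd (st_x t) + delta.
  have := model_upper (model _ xt) (relint_sub xt).
  rewrite (model_diag (model _ xt) (relint_sub xt)) subrr normr0 expr0n mulr0.
  lra.
have Hpsi := convex_function_comb (st_u t) (st_x s) _ (model_convex My) th01
  (relint_sub ut) (relint_sub xsri).
rewrite -txE in Hpsi.
(* The updates give [x_{k+1} - y_{k+1} = (alpha / A_{k+1}) (u_{k+1} - u_k)], and the equation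
   defining alpha turns [L alpha^2 / A_{k+1}] into [c_k]. *)
have Hnorm : st_L t * `|st_x t - st_y t| ^+ 2 * st_A t =
             fgm_coef mu m (st_A s) * `|st_u t - st_u s| ^+ 2.
  rewrite txE tyE opprD addrACA subrr addr0 -scalerBr normrZ.
  rewrite ger0_norm; last by case/andP: th01.
  have [/= e _] := tal; rewrite -tA in e.
  have Atn' : st_A t != 0 by rewrite gt_eqF.
  have -> : fgm_coef mu m (st_A s) = st_L t * st_alpha t ^+ 2 / st_A t.
    by rewrite -e; field.
  by field.
have Hu := Vge _ _ (relint_sub ut) us.
(* At [st_x s] the term [mu V] is discarded; at [xs] it is kept, since it absorbs the term
   [al * mu * V y xs] of phi. *)
have Hlx := model_lower My (relint_sub xsri).
have Hls := model_lower My Qxs.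
have HVx := mulr_ge0 mu0 (V0 _ _ (relint_sub xsri) yt).
have HVu := mulr_ge0 mu0 (V0 _ _ (relint_sub ut) yt).
set al := st_alpha t in tA al0 Hphi Hpsi.
move: acc; rewrite /fgm_accept => acc.
have ths : st_A t * (al / st_A t) = al by rewrite mulrC divfK// gt_eqF.
have Hpsi' : st_A t * psi (st_x t) (st_y t) <=
    al * psi (st_u t) (st_y t) + st_A s * psi (st_x s) (st_y t).
  have := ler_wpM2l (ltW At0) Hpsi.
  rewrite mulrDr mulrA ths (mulrA (st_A t) (1 - _)) mulrBr mulr1 ths.
  by have -> : st_A t - al = st_A s by rewrite tA addrK.
have Hacc := ler_wpM2l (ltW At0) (le_trans Hfx (lerD acc (lexx delta))).
have c0 : 0 <= fgm_coef mu m (st_A s) by apply: le_trans c1.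
(* Together with [Hnorm], this absorbs the quadratic term of the acceptance test into the term [c_k
   V[u_k](u_{k+1})] of phi. *)
have Hu' := ler_wpM2l c0 Hu.
have Hlx' := ler_wpM2l As0 (le_trans HVx Hlx).
have Hls' := ler_wpM2l (ltW al0) Hls.
have HVu' := mulr_ge0 (ltW al0) HVu.
rewrite -tA /fgm_phi -/V in Hphi.
have fxsE : st_A t * f xs = st_A s * f xs + al * f xs by rewrite tA mulrDl.
have fdE : st_A t * fd (st_y t) = st_A s * fd (st_y t) + al * fd (st_y t).
  by rewrite tA mulrDl.
lra.
Qed.

(** * Summation over the iterations and the two bounds *)

(** Induction on [n]. The sign conditions and [relint Q (st_x (s n))] are carried along because the
    one-step estimate requires them; [st_A] is positive only from [n = 1] on, since it starts at
    0. *)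
Lemma fgm_run_estimate {R : realType} {E : normedVectType R} {Q : set E}
    {f d : E -> R} {grad : E -> 'Hom(E, R^o)} {mu m : R}
    {delta deltat : nat -> R} {fd : R -> E -> R} {psi : R -> E -> E -> R}
    {x0 xs : E} {L0 : R} {N : nat} {s : nat -> fgm_state E}
    (V := bregman d grad) :
  @convex_set R E Q ->
  (forall y, relint Q y -> is_gradient Q d y (grad y)) ->
  0 <= mu -> 0 <= m -> (forall k, 0 <= delta k) ->
  (forall k, exists2 Lbar : R, 0 <= Lbar &
     forall y, relint Q y ->
       is_model Q V f (delta k) Lbar mu m (fd (delta k)) (psi (delta k)) y) ->
  (forall z y, Q z -> relint Q y -> 1 / 2 * `|z - y| ^+ 2 <= V y z) ->
  Q xs -> 0 < L0 ->
  fgm_run Q V mu m fd psi delta deltat x0 L0 N s ->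
  forall n, (n <= N)%N ->
  [/\ 0 < st_L (s n), 0 <= st_A (s n), (0 < n)%N -> 0 < st_A (s n),
      relint Q (st_x (s n)) &
      st_A (s n) * (f (st_x (s n)) - f xs)
      + fgm_coef mu m (st_A (s n)) * V (st_u (s n)) xs <=
      V (st_u (s 0%N)) xs + 2 * (\sum_(0 <= k < n) st_A (s k.+1) * delta k)
      + \sum_(0 <= k < n) deltat k].
Proof.
move=> Qc dg mu0 m0 delta0 model Vge Qxs L00 [init step uri yri].
elim=> [|n IHn] nN.
  (* As [x_0 = u_0], this also places [x_0] in the relative interior. With [A_0 = 0] the coefficient
     is 1 and the two sides agree. *)
  have := uri 0%N (leq0n _).
  rewrite init /= => x0ri; split=> //; rewrite !big_geq// /fgm_coef; lra.
have [Ln0 An0 _ xn IH] := IHn (ltnW nN).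
have [L _ modeln] := model n.
have [i [tri acc _]] := step n nN.
have [L0' A0' xri H] := fgm_step_estimate Qc dg mu0 m0 (delta0 n) modeln Vge Qxs
  Ln0 An0 (uri _ (ltnW nN)) xn (uri _ nN) (yri _ nN) tri acc.
split=> //; first exact: ltW.
rewrite !big_nat_recr//=; move: IH H; rewrite -/V.
lra.
Qed.

Theorem theorem3p4 (R : realType) (E : normedVectType R) (Q : set E)
    (f d : E -> R) (grad : E -> 'Hom(E, R^o))
    (mu m : R) (delta deltat : nat -> R)
    (fd : R -> E -> R) (psi : R -> E -> E -> R)
    (x0 xs : E) (L0 : R) (N : nat) (s : nat -> fgm_state E)
    (V := bregman d grad)
    (A := fun k => st_A (s k)) (u := fun k => st_u (s k))
    (x := fun k => st_x (s k)) :
  @convex_set R E Q ->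
  @convex_function R E Q d ->
  C1_relint Q d grad ->
  0 <= mu -> 0 <= m ->
  (forall k, 0 <= delta k) -> (forall k, 0 <= deltat k) ->
  (forall k, exists2 Lbar : R, 0 <= Lbar &
     forall y, relint Q y ->
       is_model Q V f (delta k) Lbar mu m (fd (delta k)) (psi (delta k)) y) ->
  (forall z y, Q z -> relint Q y -> 1 / 2 * `|z - y| ^+ 2 <= V y z) ->
  is_minimizer Q f xs ->
  0 < L0 ->
  fgm_run Q V mu m fd psi delta deltat x0 L0 N s ->
  (1 <= N)%N ->
  f (x N) - f xs <=
      V (u 0%N) xs / A N
      + 2 * (\sum_(0 <= k < N) A k.+1 * delta k) / A N
      + (\sum_(0 <= k < N) deltat k) / A N
  /\
  V (u N) xs <=
      V (u 0%N) xs / (1 + A N * mu + A N * m)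
      + 2 * (\sum_(0 <= k < N) A k.+1 * delta k) / (1 + A N * mu + A N * m)
      + (\sum_(0 <= k < N) deltat k) / (1 + A N * mu + A N * m).
Proof.
move=> Qc _ [dg _] mu0 m0 delta0 _ model Vge [Qxs xsmin] L00 run N1.
have [_ _ /(_ N1) AN0 xN H] :=
  fgm_run_estimate Qc dg mu0 m0 delta0 model Vge Qxs L00 run _ (leqnn N).
have c0 : 0 < fgm_coef mu m (A N).
  by apply: lt_le_trans ltr01 (fgm_coef_ge1 _ _ _ mu0 m0 (ltW AN0)).
have uN : relint Q (u N) by exact: run_u run _ (leqnn N).
have VN0 : 0 <= V (u N) xs.
  by apply: le_trans (Vge _ _ Qxs uN); rewrite mulr_ge0 ?sqr_ge0.
have fN0 : 0 <= f (x N) - f xs by rewrite subr_ge0 xsmin//; exact: relint_sub.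
have H1 := mulr_ge0 (ltW AN0) fN0.
have H2 := mulr_ge0 (ltW c0) VN0.
rewrite -/V -/(A N) -/(x N) -/(u N) in H H1.
(* Over a common denominator, the first bound follows from [H] by dropping the term of [H2], the
   second by dropping that of [H1]. *)
rewrite -!mulrDl; split.
  by rewrite ler_pdivlMr// mulrC; move: H; rewrite -/(u 0%N); lra.
rewrite ler_pdivlMr// mulrC; move: H.
by rewrite -/(u 0%N) /fgm_coef in H2 *; lra.
Qed.
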